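(* Let $m\ge2$ be an integer. The map sending a directed path from the root $m$ to a leaf in the butterfly tree $\mathcal T_m$ to the vector $(m,k_1,\ldots,k_j)$ of the labels of its successive vertices is a bijection from the set of all such paths onto the set $\mathcal A_m$ of admissible $m$-chains. Furthermore, for any $m\ge2$ we have $\#\mathcal A_m=\psi(m)$, where $\psi$ satisfies $\psi(1)=1$ and $$\psi(n)=\sum_{k=1}^{n-1}\psi(\gcd(n,k))\quad\text{for all }n\ge2.$$
   Context: An admissible $m$-chain is a vector $(m,k_1,\ldots,k_\ell)$ of positive integers such that $k_i<m_i:=\gcd(m,k_1,\ldots,k_{i-1})$ for all $1\le i\le\ell$, where $m_1=m$, and $\gcd(m,k_1,\ldots,k_\ell)=1$. $\mathcal A_m$ is the set of all admissible $m$-chains. The butterfly tree $\mathcal T_m$ is the finite rooted tree with labelled vertices constructed as follows: the root is labelled $m$ and has $m-1$ children labelled $1,2,\ldots,m-1$. For a non-root vertex reached from the root by the path with labels $m,k_1,\ldots,k_i$, let $g=\gcd(m,k_1,\ldots,k_i)$; if $g=1$ the vertex has no offspring (it is a leaf), and if $g>1$ it has $g-1$ children labelled $1,2,\ldots,g-1$. Edges are directed away from the root. *)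

(* Defs.v *)
From mathcomp Require Import all_boot.
From mathcomp Require Import mathcomp_extra boolp classical_sets functions cardinality.

Set Implicit Arguments.
Unset Strict Implicit.
Unset Printing Implicit Defensive.

Definition gcds (s : seq nat) : nat := foldr gcdn 0 s.

(* For c = (m, k_1, ..., k_l), nth 0 c i is k_i and gcds (take i c) is         *)
(* m_i = gcd(m, k_1, ..., k_(i-1)), for 1 <= i <= l.                           *)
Definition admissible_chain (m : nat) (c : seq nat) : Prop :=
  [/\ ohead c = Some m,
      all (fun k => 0 < k) c,
      forall i, 1 <= i < size c -> nth 0 c i < gcds (take i c)
    & gcds c = 1].

Definition admissible_chains (m : nat) : set (seq nat) :=
  [set c | admissible_chain m c]%classic.

(* A finite rooted tree whose root has the given label and the given ordered   *)
(* list of subtrees hanging from it.                                           *)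
Inductive ltree : Type := LNode of nat & seq ltree.

Definition root_label (t : ltree) : nat := let: LNode a _ := t in a.
Definition root_branches (t : ltree) : seq ltree := let: LNode _ s := t in s.

(* A vertex is identified by its address, the sequence of positions (not of    *)
(* labels) of the successive children to follow from the root.                 *)
Notation address := (seq nat).

Definition root : address := [::].

Fixpoint subtree_at (t : ltree) (v : address) : option ltree :=
  if v is i :: v' then
    if onth (root_branches t) i is Some t' then subtree_at t' v' else None
  else Some t.

Definition is_vertex (t : ltree) (v : address) : bool := isSome (subtree_at t v).

Definition label (t : ltree) (v : address) : nat :=
  if subtree_at t v is Some t' then root_label t' else 0.

Definition out_degree (t : ltree) (v : address) : nat :=
  if subtree_at t v is Some t' then size (root_branches t') else 0.

Definition edge (t : ltree) : rel address :=
  fun v w => w \in [seq rcons v i | i <- iota 0 (out_degree t v)].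

Definition is_leaf (t : ltree) (v : address) : bool :=
  is_vertex t v && (out_degree t v == 0).

Definition root_leaf_path (t : ltree) (p : seq address) : bool :=
  if p is v :: q then [&& v == root, path (edge t) v q & is_leaf t (last v q)]
  else false.

(* p lists the labels on the path from the root to the vertex being expanded;  *)
(* n bounds the remaining depth.                                               *)
Fixpoint grow (n : nat) (p : seq nat) : ltree :=
  LNode (last 0 p)
    (if n is n'.+1 then [seq grow n' (rcons p k) | k <- iota 1 (gcds p).-1]
     else [::]).

Definition butterfly_below (p : seq nat) : ltree := grow (gcds p) p.

Definition butterfly (m : nat) : ltree := butterfly_below [:: m].

Lemma gcds_rcons (p : seq nat) (k : nat) : gcds (rcons p k) = gcdn (gcds p) k.
Proof.
rewrite /gcds; elim: p => [|a p IH] /=; first by rewrite gcdn0 gcd0n.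
by rewrite IH gcdnA.
Qed.

Lemma growE (n : nat) (p : seq nat) : gcds p <= n -> grow n p = butterfly_below p.
Proof.
rewrite /butterfly_below.
suff H : forall N n1 n2 q, gcds q <= N -> gcds q <= n1 -> gcds q <= n2 ->
    grow n1 q = grow n2 q by move=> le_n; exact: (H (gcds p)).
elim=> [|N IH] n1 n2 q.
  rewrite leqn0 => /eqP q0 _ _.
  by case: n1 => [|n1]; case: n2 => [|n2]; rewrite /= ?q0.
move=> leN le1 le2.
have [g0|g0] := leqP (gcds q) 0.
  move: g0; rewrite leqn0 => /eqP q0.
  by case: (n1) => [|?]; case: (n2) => [|?]; rewrite /= ?q0.
case: n1 le1 => [|n1] le1; first by rewrite leqNgt g0 in le1.
case: n2 le2 => [|n2] le2; first by rewrite leqNgt g0 in le2.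
rewrite /=; congr LNode; apply/eq_in_map => k.
rewrite mem_iota add1n prednK // => /andP[k0 kg].
have lt_g : gcds (rcons q k) < gcds q.
  by rewrite gcds_rcons; apply: leq_ltn_trans kg; apply: dvdn_leq; rewrite ?dvdn_gcdr.
by apply: IH; rewrite -ltnS; apply: (leq_trans lt_g).
Qed.

(* The depth bound in butterfly_below never truncates the tree.                *)
Lemma butterfly_belowE (p : seq nat) :
  butterfly_below p =
    LNode (last 0 p)
      [seq butterfly_below (rcons p k) | k <- iota 1 (gcds p).-1].
Proof.
rewrite {1}/butterfly_below; case E: (gcds p) => [|g] //=.
rewrite E /=; congr LNode; apply/eq_in_map => k.
rewrite mem_iota add1n ltnS => /andP[k0 kg].
apply: growE; rewrite gcds_rcons.
by apply: leq_trans kg; apply: dvdn_leq; rewrite ?dvdn_gcdr.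
Qed.

Definition psi_recurrence (psi : nat -> nat) : Prop :=
  psi 1 = 1 /\
  forall n, 2 <= n -> psi n = \sum_(1 <= k < n) psi (gcdn n k).

Lemma psi_recurrence_exists : exists psi, psi_recurrence psi.
Proof.
pose f := fix f (N n : nat) : nat := if N is N'.+1 then
   (if n == 1 then 1 else \sum_(1 <= k < n) f N' (gcdn n k)) else 0.
have fE : forall N1 N2 n, 0 < n -> n <= N1 -> n <= N2 -> f N1 n = f N2 n.
  elim=> [|N1 IH] [|N2] n n0 l1 l2; do 1?[by move: (leq_trans n0 l1) | by move: (leq_trans n0 l2)].
  have fS N : f N.+1 n =
      if n == 1 then 1 else \sum_(1 <= k < n) f N (gcdn n k) by [].
  rewrite !fS; case: eqP => // _; apply: eq_big_nat => k /andP[k0 kn].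
  have gk : gcdn n k < n.
    by apply: leq_ltn_trans kn; apply: dvdn_leq; rewrite ?dvdn_gcdr.
  by apply: IH; rewrite ?gcdn_gt0 ?n0 // -ltnS; apply: (leq_trans gk).
exists (fun n => f n n); split=> // -[|[|n]] // _.
rewrite [LHS](_ : _ = \sum_(1 <= k < n.+2) f n.+1 (gcdn n.+2 k)) //.
apply: eq_big_nat => k /andP[k0 kn].
have gk : gcdn n.+2 k < n.+2.
  by apply: leq_ltn_trans kn; apply: dvdn_leq; rewrite ?dvdn_gcdr.
by apply: fE; rewrite ?gcdn_gt0.
Qed.

(* Main.v *)
Require Import Defs.
From mathcomp Require Import all_boot.
From mathcomp Require Import mathcomp_extra boolp classical_sets functions cardinality.

(** Admissibility of (m, k_1, ..., k_l) can be read off one label at a time: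
    whether a chain may be continued by k, and whether it may stop, depends on
    the labels already chosen only through their gcd g, namely 0 < k < g and
    g = 1 respectively.  [descent] states this recursively.  The butterfly tree
    obeys the same rule, since by [butterfly_belowE] the vertex reached by labels
    of gcd g has exactly g - 1 children, labelled 1, ..., g - 1.  As siblings
    carry distinct labels, a vertex is determined by its parent and its label, so
    a path is recovered from its labels by following them down the tree
    ([follow]): that gives injectivity ([path_follow]), and following the labels
    of an admissible chain always ends in a leaf ([follow_path]), which gives
    surjectivity.

    For the count, a descent from g >= 2 consists of a first label k with
    0 < k < g and an arbitrary descent from gcd(g, k) < g.  Listing the descents
    in this way ([descents]) produces a duplicate-free list whose length satisfies
    the recurrence of psi. *)

(** * Chains as descents of the gcd *)

Fixpoint descent (g : nat) (ks : seq nat) : bool :=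
  if ks is k :: ks' then (0 < k < g) && descent (gcdn g k) ks' else g == 1.

(** The gcd of the labels preceding [ks] is kept as a parameter [g], because
    unfolding one step of [descent] absorbs the first label into it. *)
Lemma descentP (g : nat) (ks : seq nat) :
  descent g ks <->
  [/\ all (fun k => 0 < k) ks,
      forall i, i < size ks -> nth 0 ks i < gcdn g (gcds (take i ks))
    & gcdn g (gcds ks) = 1].
Proof.
elim: ks g => [|k ks IH] g /=.
  by rewrite /gcds /= gcdn0; split=> [/eqP->|[_ _ ->]].
split=> [/andP[/andP[k0 kg]] /IH[pos lt gcd1]|[/andP[k0 pos] lt gcd1]].
  split; rewrite ?k0 //; last by rewrite /= gcdnA.
  by case=> [|i] /= ltis; rewrite ?gcdn0 // gcdnA lt.
have := lt 0 isT; rewrite /= gcdn0 k0 => -> /=.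
apply/IH; split=> // [i ltis|]; rewrite -gcdnA //.
exact: (lt i.+1).
Qed.

Lemma admissible_chainE (m : nat) (c : seq nat) : 0 < m ->
  admissible_chain m c <-> exists2 ks, c = m :: ks & descent m ks.
Proof.
move=> m0; split=> [[] | [ks -> /descentP[pos lt gcd1]]].
  case: c => //= _ ks [->] /andP[_ pos] lt gcd1; exists ks => //.
  by apply/descentP; split=> // i ltis; apply: (lt i.+1).
by split=> //= [|[|i] //=]; [rewrite m0 | exact: lt].
Qed.

(** * Following labels in the tree *)

Lemma subtree_at_rcons (t : ltree) (v : address) (i : nat) :
  subtree_at t (rcons v i) =
  if subtree_at t v is Some t' then onth (root_branches t') i else None.
Proof.
elim: v t => [|j v IH] t /=; first by case: (onth _ _).
by case: (onth _ _).
Qed.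

(** Labels start at 1 and positions among siblings at 0, so the child labelled
    [k] sits at position [k.-1]. *)
Definition follow (v : address) (ks : seq nat) : seq address :=
  scanl (fun w k => rcons w k.-1) v ks.

Section ButterflyVertex.

(** A vertex [v] of an arbitrary tree [t] whose subtree is a butterfly tree: the
    label sequence [s] grows along a path while [t] stays the whole tree. *)
Variables (t : ltree) (v : address) (s : seq nat).
Hypothesis at_v : subtree_at t v = Some (butterfly_below s).

Lemma out_degree_butterfly : out_degree t v = (gcds s).-1.
Proof. by rewrite /out_degree at_v butterfly_belowE /= size_map size_iota. Qed.

Lemma label_butterfly : label t v = last 0 s.
Proof. by rewrite /label at_v butterfly_belowE. Qed.

Lemma is_leaf_butterfly : 0 < gcds s -> is_leaf t v = (gcds s == 1).
Proof.
move=> g0; rewrite /is_leaf /is_vertex out_degree_butterfly at_v /=.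
by case: (gcds s) g0.
Qed.

Lemma subtree_at_child (k : nat) : 0 < k < gcds s ->
  subtree_at t (rcons v k.-1) = Some (butterfly_below (rcons s k)).
Proof.
case: k => //= k ltk; rewrite subtree_at_rcons at_v butterfly_belowE /=.
have lt' : k < (gcds s).-1 by case: (gcds s) ltk.
by rewrite onthE -map_comp (nth_map 0) ?size_iota // nth_iota // add1n.
Qed.

Lemma edgeP (w : address) :
  reflect (exists2 k, 0 < k < gcds s & w = rcons v k.-1) (edge t v w).
Proof.
rewrite /edge out_degree_butterfly; apply: (iffP mapP) => [[i]|[k ltk ->]].
  rewrite mem_iota add0n /= => lti ->; exists i.+1 => //=.
  by case: (gcds s) lti.
exists k.-1 => //; rewrite mem_iota add0n /=.
by case: k ltk => //= k; case: (gcds s).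
Qed.

End ButterflyVertex.

Lemma gcds_rcons_gt0 (s : seq nat) (k : nat) :
  0 < gcds s -> 0 < gcds (rcons s k).
Proof. by rewrite gcds_rcons gcdn_gt0 => ->. Qed.

(** Since each step is forced by the label of its target, a path to a leaf is a
    function of its labels; [descent] holds because the labels of the children
    of a vertex are exactly the admissible continuations. *)
Lemma path_follow (t : ltree) (v : address) (s : seq nat) (q : seq address) :
  subtree_at t v = Some (butterfly_below s) -> 0 < gcds s ->
  path (edge t) v q -> is_leaf t (last v q) ->
  q = follow v (map (label t) q) /\ descent (gcds s) (map (label t) q).
Proof.
elim: q v s => [|w q IH] v s at_v g0 /=.
  by rewrite (is_leaf_butterfly _ _ _ at_v).
case/andP=> /(edgeP _ _ _ at_v)[k ltk ->].
have at_w := subtree_at_child _ _ _ at_v k ltk.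
move=> /(IH _ _ at_w (gcds_rcons_gt0 _ k g0)) /[apply] -[qE dq].
rewrite (label_butterfly _ _ _ at_w) last_rcons ltk -gcds_rcons; split=> //.
by rewrite {1}qE.
Qed.

(** The converse of [path_follow]: each continuation allowed by [descent] is
    the label of some child, and the stopping condition [g = 1] leaves the last
    vertex childless. *)
Lemma follow_path (t : ltree) (v : address) (s ks : seq nat) :
  subtree_at t v = Some (butterfly_below s) -> 0 < gcds s ->
  descent (gcds s) ks ->
  [/\ path (edge t) v (follow v ks), is_leaf t (last v (follow v ks))
    & map (label t) (follow v ks) = ks].
Proof.
elim: ks v s => [|k ks IH] v s at_v g0 /=.
  by rewrite (is_leaf_butterfly _ _ _ at_v).
case/andP=> ltk; rewrite -gcds_rcons => dks.
have at_w := subtree_at_child _ _ _ at_v k ltk.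
have [-> -> ->] := IH _ _ at_w (gcds_rcons_gt0 _ k g0) dks.
rewrite (label_butterfly _ _ _ at_w) last_rcons andbT; split=> //.
by apply/(edgeP _ _ _ at_v); exists k.
Qed.

(** * Counting descents *)

(** The argument [n] bounds the recursion depth; [n >= g] suffices because every
    step replaces [g] by a proper divisor. *)
Fixpoint descents (n g : nat) : seq (seq nat) :=
  if n is n'.+1 then
    if g == 1 then [:: [::]]
    else [seq k :: ks | k <- iota 1 g.-1, ks <- descents n' (gcdn g k)]
  else [::].

Lemma gcdn_descent (n g k : nat) : 0 < k < g -> g <= n.+1 -> 0 < gcdn g k <= n.
Proof.
move=> /andP[k0 ltkg] legn; rewrite gcdn_gt0 k0 orbT -ltnS.
by apply: leq_trans legn; apply: leq_ltn_trans ltkg; rewrite dvdn_leq ?dvdn_gcdr.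
Qed.

Lemma mem_iota_pred (g k : nat) : (k \in iota 1 g.-1) = (0 < k < g).
Proof. by rewrite mem_iota add1n; case: g => //=; case: k. Qed.

Lemma mem_descents (n g : nat) (ks : seq nat) : 0 < g <= n ->
  (ks \in descents n g) = descent g ks.
Proof.
elim: n g ks => [|n IH] g ks /andP[g0 legn]; first by case: g g0 legn.
rewrite /=; case: eqVneq => [->|g1].
  by rewrite inE; case: ks => //= k ks; case: k.
apply/allpairsPdep/idP => [[k [ks' [+ + ->]]]|].
  rewrite mem_iota_pred => ltk; rewrite IH; last exact: gcdn_descent.
  by rewrite /= ltk.
case: ks => [|k ks] /=; first by rewrite (negPf g1).
case/andP=> ltk dks; exists k, ks; rewrite mem_iota_pred; split=> //.
by rewrite IH //; exact: gcdn_descent.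
Qed.

Lemma uniq_descents (n g : nat) : uniq (descents n g).
Proof.
elim: n g => //= n IH g; case: ifP => // _.
apply: allpairs_uniq_dep => //; first exact: iota_uniq.
by move=> [k ks] [k' ks'] _ _ /= [-> ->].
Qed.

Lemma size_descents (psi : nat -> nat) (n g : nat) : psi_recurrence psi ->
  0 < g <= n -> size (descents n g) = psi g.
Proof.
case=> psi1 psiS; elim: n g => [|n IH] g /andP[g0 legn].
  by case: g g0 legn.
rewrite /=; case: eqVneq => [->|g1]; first by rewrite psi1.
rewrite psiS; last by case: g g0 g1 {legn} => [|[]].
rewrite size_allpairs_dep sumnE big_map /index_iota subn1.
rewrite big_seq [RHS]big_seq; apply: eq_bigr => k; rewrite mem_iota_pred => ltk.
by apply: IH; exact: gcdn_descent.
Qed.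

Local Open Scope classical_set_scope.
Local Open Scope card_scope.

Lemma card_eq_uniq (T : eqType) (s : seq T) (A : set T) :
  uniq s -> (forall x, A x <-> x \in s) -> A #= `I_(size s).
Proof.
move=> uniq_s AE; apply/card_set_bijP; exists (index^~ s); split.
- by move=> x /AE xs /=; rewrite index_mem.
- move=> x y /set_mem/AE xs /set_mem/AE ys eq_i.
  by rewrite -(nth_index x xs) eq_i nth_index.
- move=> i /= ltis; case: s ltis uniq_s AE => // x0 s ltis uniq_s AE.
  by exists (nth x0 (x0 :: s) i); [apply/AE; exact: mem_nth | exact: index_uniq].
Qed.

Theorem proposition1p2 (m : nat) (hm : 2 <= m) :
  set_bij [set p : seq address | root_leaf_path (butterfly m) p]
          (admissible_chains m)
          (map (label (butterfly m)))
  /\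
  (forall psi : nat -> nat, psi_recurrence psi ->
     admissible_chains m #= `I_(psi m)).
Proof.
have m0 : 0 < m by exact: ltnW.
have at_root : subtree_at (butterfly m) Defs.root = Some (butterfly_below [:: m]) by [].
have gm : gcds [:: m] = m by rewrite /gcds /= gcdn0.
have g0 : 0 < gcds [:: m] by rewrite gm.
have label_root : label (butterfly m) Defs.root = m.
  exact: label_butterfly at_root.
split; last first.
  move=> psi psiP; have lem : 0 < m <= m by rewrite m0 leqnn.
  rewrite -(size_descents _ _ _ psiP lem) -(size_map (cons m)).
  apply: card_eq_uniq => [|c].
    by rewrite map_inj_uniq ?uniq_descents // => ? ? [].
  rewrite /admissible_chains /= admissible_chainE //.
  split=> [[ks -> dks]|/mapP[ks + ->]]; last by rewrite mem_descents //; exists ks.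
  by apply/mapP; exists ks => //; rewrite mem_descents.
have pathP p : root_leaf_path (butterfly m) p ->
    exists ks, [/\ p = Defs.root :: follow Defs.root ks, descent m ks
                 & map (label (butterfly m)) p = m :: ks].
  case: p => //= _ q /and3P[/eqP-> pq leafq].
  have [qE dq] := path_follow _ _ _ _ at_root g0 pq leafq.
  exists (map (label (butterfly m)) q); rewrite -qE -{1}gm.
  by rewrite label_root.
split.
- move=> p /pathP[ks [_ dks ->]].
  by apply/(admissible_chainE _ _ m0); exists ks.
- move=> p p' /set_mem/pathP[ks [-> _ ->]] /set_mem/pathP[ks' [-> _ ->]].
  by case=> ->.
- move=> c /(admissible_chainE _ _ m0)[ks -> dks].
  rewrite -gm in dks.
  have [pq leafq lq] := follow_path _ _ _ _ at_root g0 dks.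
  exists (Defs.root :: follow Defs.root ks); first by rewrite /= pq leafq.
  by rewrite /= lq label_root.
Qed.
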